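(* Let the sequences be generated by Algorithm 1 (described in the context), assumed not to stop. Suppose there exist $\overline\lambda\ge\underline\lambda>0$ such that $\lambda_i^k\in[\underline\lambda,\overline\lambda]$ for all $k\ge 0$ and all $i=1,\dots,n$, that $\sup_{k\ge0}\alpha_k<+\infty$, and that $\sum_{k=0}^\infty\beta_k^2<+\infty$. Let $p^k=(z^k,w_1^k,\dots,w_{n-1}^k)$ and $w_n^k:=-\sum_{i=1}^{n-1}G_i^*w_i^k$. Then $(p^k)$ converges strongly to $p^*:=(z^*,w_1^*,\dots,w_{n-1}^* )$, where $p^*$ is the orthogonal projection (with respect to $\langle\cdot,\cdot\rangle_\gamma$) of $p^0$ onto $\mathcal S_e$; $(z^k)$ converges strongly to $z^*$, which is a solution of $0\in\sum_{i=1}^nG_i^*T_i(G_iz)$; and $(w_i^k)$ converges strongly to $w_i^*$ for $1\le i\le n$, where $w_n^*:=-\sum_{i=1}^{n-1}G_i^*w_i^*$. Moreover, for $i=1,\dots,n$, the sequences $(x_i^k)$ and $(y_i^k)$ converge strongly to $G_iz^*$ and $w_i^*$, respectively.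
   Context: Setting. Let $n\ge2$, let $\mathcal H_0,\dots,\mathcal H_{n-1}$ be real Hilbert spaces and $\mathcal H_n:=\mathcal H_0$; inner products and norms are written $\langle\cdot,\cdot\rangle$ and $\|\cdot\|$. For $i=1,\dots,n$, $T_i:\mathcal H_i\rightrightarrows\mathcal H_i$ is a (set-valued) maximal monotone operator and $G_i:\mathcal H_0\to\mathcal H_i$ is a bounded linear operator with adjoint $G_i^*$; $G_n=I$ is the identity. The problem is to find $z\in\mathcal H_0$ with $0\in\sum_{i=1}^nG_i^*T_i(G_iz)$; it is assumed to have at least one solution. For a set-valued map $T$ on a Hilbert space and $\varepsilon\ge0$, $T^{[\varepsilon]}(x)=\{u:\langle x-y,u-v\rangle\ge-\varepsilon\text{ for all }y\text{ and all }v\in T(y)\}$. For $\gamma>0$, the space $\boldsymbol{\mathcal H}:=\mathcal H_0\times\mathcal H_1\times\dots\times\mathcal H_{n-1}$ carries $\langle (z,w),(z',w')\rangle_\gamma=\gamma\langle z,z'\rangle+\sum_{i=1}^{n-1}\langle w_i,w_i'\rangle$ and $\|p\|_\gamma=\sqrt{\langle p,p\rangle_\gamma}$; $P_C$ denotes orthogonal projection onto a nonempty closed convex set $C$ in this space. The extended-solution set is the (nonempty closed convex) set $$\mathcal S_e=\Big\{(z,w_1,\dots,w_{n-1})\in\boldsymbol{\mathcal H}: w_i\in T_i(G_iz),\ i=1,\dots,n-1,\ -\sum_{i=1}^{n-1}G_i^*w_i\in T_n(z)\Big\}.$$ Algorithm 1. Input: $p^{-1}=p^0=(z^0,w_1^0,\dots,w_{n-1}^0)\in\boldsymbol{\mathcal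 H}$ (so $z^{-1}=z^0$, $w_i^{-1}=w_i^0$), $0\le\sigma<1$, $\gamma>0$. For $k=0,1,\dots$: (1) Choose $\alpha_k,\beta_k\ge0$ and set $\widehat z^k=z^k+\alpha_k(z^k-z^{k-1})$, $\widetilde z^k=\widehat z^k+\beta_k(\widehat z^k-z^0)$; for $i=1,\dots,n-1$: $\widehat w_i^k=w_i^k+\alpha_k(w_i^k-w_i^{k-1})$, $\widetilde w_i^k=\widehat w_i^k+\beta_k(\widehat w_i^k-w_i^0)$; and $\widetilde w_n^k=-\sum_{i=1}^{n-1}G_i^*\widetilde w_i^k$. (2) For $i=1,\dots,n$, choose $\lambda_i^k>0$ and compute $(x_i^k,y_i^k,\varepsilon_i^k)\in\mathcal H_i\times\mathcal H_i\times[0,\infty)$ with $y_i^k\in T_i^{[\varepsilon_i^k]}(x_i^k)$ and $$\|\lambda_i^ky_i^k+x_i^k-(G_i\widetilde z^k+\lambda_i^k\widetilde w_i^k)\|^2+2\lambda_i^k\varepsilon_i^k\le\sigma^2\big(\|G_i\widetilde z^k-x_i^k\|^2+\|\lambda_i^k(\widetilde w_i^k-y_i^k)\|^2\big).$$ (3) If $x_i^k=G_ix_n^k$ for $i=1,\dots,n-1$ and $\sum_{i=1}^{n-1}G_i^*y_i^k+y_n^k=0$, stop and return $(\overline z,\overline w_1,\dots,\overline w_{n-1}):=(x_n^k,y_1^k,\dots,y_{n-1}^k)$. (4) Otherwise let $\varphi_k(p)=\sum_{i=1}^n\big(\langle G_iz-x_i^k,y_i^k-w_i\rangle-\varepsilon_i^k\big)$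 for $p=(z,w_1,\dots,w_{n-1})$, with $w_n:=-\sum_{i=1}^{n-1}G_i^*w_i$; let $p^k=(z^k,w_1^k,\dots,w_{n-1}^k)$, $H_k=\{p:\varphi_k(p)\le0\}$, $W_k=\{p:\langle p^0-p^k,p-p^k\rangle_\gamma\le0\}$, and set $p^{k+1}=(z^{k+1},w_1^{k+1},\dots,w_{n-1}^{k+1})=P_{H_k\cap W_k}(p^0)$. *)

(* Defs.v *)
From HB Require Import structures.
From mathcomp Require Import all_boot all_order all_algebra.
From mathcomp Require Import all_classical all_reals all_analysis.

Set Implicit Arguments.
Unset Strict Implicit.
Unset Printing Implicit Defensive.

Import Order.TTheory GRing.Theory Num.Theory numFieldNormedType.Exports.

Local Open Scope classical_set_scope.
Local Open Scope ring_scope.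

HB.mixin Record CompleteNormedModule_isHilbert (R : realType) V
    of CompleteNormedModule R V := {
  inner : {dot V for idfun} ;
  norm_inner : forall x : V, `|x| = Num.sqrt (inner x x)
}.

#[short(type="hilbertType")]
HB.structure Definition Hilbert (R : realType) :=
  {V of CompleteNormedModule R V & CompleteNormedModule_isHilbert R V}.

Notation "''[' u , v ]" := (inner u v) : ring_scope.

Section Operators.
Context {R : realType}.
Implicit Types V W : hilbertType R.

Definition bounded_op V W (f : V -> W) : Prop :=
  exists M : R, forall x, `|f x| <= M * `|x|.

Definition is_adjoint V W (f : V -> W) (g : W -> V) : Prop :=
  forall x u, '[f x, u] = '[x, g u].

Definition monotone V (T : V -> set V) : Prop :=
  forall x y u v, T x u -> T y v -> 0 <= '[x - y, u - v].

Definition maximal_monotone V (T : V -> set V) : Prop :=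
  monotone T /\
  forall S : V -> set V, monotone S -> (forall x, T x `<=` S x) -> S = T.

Definition enlargement V (T : V -> set V) (eps : R) (x : V) : set V :=
  [set u | forall y v, T y v -> - eps <= '[x - y, u - v]].

End Operators.

(* The number of operators is [n.+2], i.e. an arbitrary integer >= 2, written N
   in these comments. The convention H_N = H_0 is built into the index type:
   the indices 1, ..., N of the operators are represented by 'I_N with [ord0]
   standing for N. The same type indexes the blocks of the product space
   H_0 x H_1 x ... x H_(N-1), whose points p = (z, w_1, ..., w_(N-1)) have
   z = p ord0 and w_i = p i for i != ord0. *)
Section Problem.
Context {R : realType} {n : nat} {H : 'I_n.+2 -> hilbertType R}.

Local Notation point := (forall i, H i).

Variables (T : forall i, H i -> set (H i)).
Variables (G : forall i, H ord0 -> H i) (Gs : forall i, H i -> H ord0).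

Definition solution (z : H ord0) : Prop :=
  exists u : point, (forall i, T (G i z) (u i)) /\ \sum_i Gs (u i) = 0.

Definition wlast (p : point) : H ord0 := - \sum_(i | i != ord0) Gs (p i).

(* The family (w_1, ..., w_N) of a point, with w_N = wlast p at index ord0. *)
Definition wpart (p : point) : point := dfwith p ord0 (wlast p).

Definition extended_solutions : set point :=
  [set p : point | (forall i, i != ord0 -> T (G i (p ord0)) (p i)) /\
           T (p ord0) (wlast p)].

Definition sub_point (p q : point) : point := fun i => p i - q i.

Definition inner_gamma (gamma : R) (p q : point) : R :=
  gamma * '[p ord0, q ord0] + \sum_(i | i != ord0) '[p i, q i].

Definition norm_gamma (gamma : R) (p : point) : R :=
  Num.sqrt (inner_gamma gamma p p).

Definition is_projection (gamma : R) (C : set point) (p q : point) : Prop :=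
  C q /\ forall r, C r ->
    norm_gamma gamma (sub_point p q) <= norm_gamma gamma (sub_point p r).

Variables (sigma gamma : R) (alpha beta : nat -> R).
Variables (lambda eps : nat -> 'I_n.+2 -> R) (p x y : nat -> point).

(* [k.-1] is 0 for k = 0, which encodes p^{-1} = p^0. *)
Definition phat (k : nat) : point :=
  fun i => p k i + alpha k *: (p k i - p k.-1 i).

Definition ptilde (k : nat) : point :=
  fun i => phat k i + beta k *: (phat k i - p 0%N i).

Definition ztilde (k : nat) : H ord0 := ptilde k ord0.

Definition wtilde (k : nat) : point := wpart (ptilde k).

Definition stops (k : nat) : Prop :=
  (forall i, i != ord0 -> x k i = G i (x k ord0)) /\
  \sum_(i | i != ord0) Gs (y k i) + y k ord0 = 0.

Definition phi (k : nat) (q : point) : R :=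
  \sum_i ('[G i (q ord0) - x k i, y k i - wpart q i] - eps k i).

Definition Hset (k : nat) : set point := [set q : point | phi k q <= 0].

Definition Wset (k : nat) : set point :=
  [set q : point | inner_gamma gamma (sub_point (p 0%N) (p k))
                             (sub_point q (p k)) <= 0].

(* An infinite run: [never_stops] excludes termination at every iteration. *)
Record algorithm1 : Prop := Algorithm1 {
  sigma_range : 0 <= sigma < 1 ;
  gamma_gt0 : 0 < gamma ;
  alpha_ge0 : forall k, 0 <= alpha k ;
  beta_ge0 : forall k, 0 <= beta k ;
  lambda_gt0 : forall k i, 0 < lambda k i ;
  eps_ge0 : forall k i, 0 <= eps k i ;
  y_enlargement : forall k i, enlargement (@T i) (eps k i) (x k i) (y k i) ;
  error_criterion : forall k i,
    `| lambda k i *: y k i + x k i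
       - (G i (ztilde k) + lambda k i *: wtilde k i) | ^+ 2
      + 2 * lambda k i * eps k i
    <= sigma ^+ 2 * (`| G i (ztilde k) - x k i | ^+ 2
                     + `| lambda k i *: (wtilde k i - y k i) | ^+ 2) ;
  never_stops : forall k, ~ stops k ;
  next_iterate : forall k,
    is_projection gamma (Hset k `&` Wset k) (p 0%N) (p k.+1)
}.

End Problem.

(* Main.v *)
Require Import Defs.
From HB Require Import structures.
From mathcomp Require Import all_boot all_order all_algebra.
From mathcomp Require Import all_classical all_reals all_analysis.
From mathcomp Require Import ring lra.
Import Order.TTheory GRing.Theory Num.Theory numFieldNormedType.Exports.
Local Open Scope classical_set_scope.
Local Open Scope ring_scope.

(** The method is a Haugazeau scheme.  Every half-space H_k contains the
    extended-solution set S, and projecting p^0 onto H_k and W_k keeps S inside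
    W_(k+1) by the variational inequality of the projection.  Hence the
    distances from p^0 to p^k increase, stay below the distance from p^0 to any
    point of S, and the increments p^(k+1) - p^k tend to zero
    ([haugazeau_sub], [haugazeau_dist], [haugazeau_step]).  Since alpha_k is
    bounded and beta_k tends to zero, the extrapolated point ptilde^k is
    asymptotically p^k, hence also p^(k+1) ([lookahead_null]).

    The relative-error criterion makes phi_k at ptilde^k at least a fixed
    multiple of the squared residuals |G_i z~ - x_i|^2 + |y_i - w~_i|^2
    ([relative_error_lower_bound]), whereas phi_k is nonpositive at p^(k+1).
    Comparing the two values bounds the residuals by the vanishing distance
    between these points ([residual_bound], [residual_null]), so that x_i^k and
    y_i^k are asymptotically G_i z^k and w_i^k, and eps_i^k tends to zero.

    For a_i, b_i in the graphs of the T_i the function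
      q |-> sum_i <G_i z - a_i, b_i - w_i>
    is affine in q = (z, w), because the cross terms <G_i z, w_i> add up to
    zero ([separatorE]).  By maximality S is the set where all these functions
    are nonpositive ([extended_solutions_separator]), and the previous estimates
    show that their upper limits along (p^k) are nonpositive
    ([separator_iterate_le]).  A point which lies in every closed convex set
    that eventually contains the iterates therefore lies in S.

    Such a point is produced without weak compactness: near-nearest points to
    p^0 in the closed convex hulls of the tails form a Cauchy sequence, by the
    parallelogram law, and its limit c belongs to all the hulls ([hull_limit]).
    Since c is in S, no iterate is farther from p^0 than c, and the
    parallelogram law applied to p^k and c turns this into strong convergence
    of p^k to c ([haugazeau_cvg]).  The point c is then the projection of p^0
    onto S. *)

Set Implicit Arguments.
Unset Strict Implicit.
Unset Printing Implicit Defensive.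

(** * Geometry of a complete positive form *)

Lemma null_le (R : realType) (a b : nat -> R) : (forall k, 0 <= a k <= b k) ->
  b k @[k --> \oo] --> (0 : R) -> a k @[k --> \oo] --> (0 : R).
Proof.
move=> ab b0; apply: squeeze_cvgr b0; last exact: cvg_cst.
exact: nearW.
Qed.

(** The product space is met only through its weighted form, so the geometry is
    developed for a form on a bare module, and convergence, closedness and
    completeness are expressed by sequences of reals. *)
Record prehilbert_form (R : realType) (E : lmodType R) (B : E -> E -> R) : Prop := {
  form_sym : forall u v, B u v = B v u ;
  form_linear : forall w, linear_for *%R (B ^~ w) ;
  form_ge0 : forall u, 0 <= B u u
}.

Section PreHilbert.
Variables (R : realType) (E : lmodType R) (B : E -> E -> R).
Variable Bform : prehilbert_form B.

Local Notation N u := (B u u).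

Lemma formDl u v w : B (u + v) w = B u w + B v w.
Proof. by have := form_linear Bform w 1 u v; rewrite /= scale1r mul1r. Qed.

Lemma form0l w : B 0 w = 0.
Proof. by apply: (@addrI _ (B 0 w)); rewrite -formDl !addr0. Qed.

Lemma formZl a u w : B (a *: u) w = a * B u w.
Proof. by have := form_linear Bform w a u 0; rewrite /= addr0 form0l addr0. Qed.

Lemma formNl u w : B (- u) w = - B u w.
Proof. by rewrite -scaleN1r formZl mulN1r. Qed.

Lemma formBl u v w : B (u - v) w = B u w - B v w.
Proof. by rewrite formDl formNl. Qed.

Lemma formDr u v w : B w (u + v) = B w u + B w v.
Proof. by rewrite !(form_sym Bform w) formDl. Qed.

Lemma formZr a u w : B w (a *: u) = a * B w u.
Proof. by rewrite !(form_sym Bform w) formZl. Qed.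

Lemma formNr u w : B w (- u) = - B w u.
Proof. by rewrite !(form_sym Bform w) formNl. Qed.

Lemma formBr u v w : B w (u - v) = B w u - B w v.
Proof. by rewrite !(form_sym Bform w) formBl. Qed.

Definition formsE := (formDl, formDr, formNl, formNr, formZl, formZr).

Lemma form_distC u v : N (u - v) = N (v - u).
Proof. by rewrite -[u - v]opprB formNl formNr opprK. Qed.

Lemma form_sqrB u v : N (u - v) = N u - 2 * B u v + N v.
Proof. by rewrite !formsE (form_sym Bform v u); ring. Qed.

(** The expansion of the nonnegative square of t u - v, divided by t. *)
Lemma form_young t u v : 0 < t -> 2 * B u v <= t * N u + t^-1 * N v.
Proof.
move=> t0; have := form_ge0 Bform (t *: u - v).
rewrite !formsE (form_sym Bform v u) => h.
rewrite -subr_ge0.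
have -> : t * N u + t^-1 * N v - 2 * B u v =
  t^-1 * (t * (t * N u) - 2 * t * B u v + N v) by field; rewrite gt_eqF.
by rewrite mulr_ge0 ?invr_ge0 ?(ltW t0)//; lra.
Qed.

(** The parallelogram law for u - o and v - o, written with the midpoint of u
    and v: it turns bounds on distances to o into bounds on N (u - v) as soon as
    the midpoint is known to be far from o. *)
Lemma form_parallelogram u v o :
  N (u - v) = 2 * N (u - o) + 2 * N (v - o) - 4 * N (u + 2^-1 *: (v - u) - o).
Proof.
rewrite !formsE (form_sym Bform v u) (form_sym Bform o u) (form_sym Bform o v).
by field.
Qed.

Definition form_cvg (u : nat -> E) (c : E) : Prop :=
  N (u k - c) @[k --> \oo] --> (0 : R).

(** Completeness with an explicit Cauchy modulus; the modulus is what the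
    parallelogram law yields directly. *)
Definition form_complete : Prop :=
  forall (u : nat -> E) (eta : nat -> R), eta k @[k --> \oo] --> (0 : R) ->
  (forall m j, (m <= j)%N -> N (u m - u j) <= eta m) ->
  exists c, form_cvg u c.

Definition form_closed (A : set E) : Prop :=
  forall u c, (forall k, A (u k)) -> form_cvg u c -> A c.

Definition is_convex (A : set E) : Prop :=
  forall u v t, 0 <= t <= 1 -> A u -> A v -> A (u + t *: (v - u)).

Definition form_projection (A : set E) (o q : E) : Prop :=
  A q /\ forall r, A r -> N (o - q) <= N (o - r).

(** Semicontinuity of the squared distance to o under B-convergence.  Young's
    inequality with parameter t bounds N (c - o) by (1 + t) L for every t > 0,
    which avoids square roots. *)
Lemma form_norm_lim (u : nat -> E) (a : nat -> R) c o (L : R) :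
  form_cvg u c -> a k @[k --> \oo] --> L -> (forall k, N (u k - o) <= a k) ->
  N (c - o) <= L.
Proof.
move=> uc aL ua.
have key t : 0 < t -> N (c - o) <= (1 + t) * L.
  move=> t0.
  have : (1 + t) * a k + (1 + t^-1) * N (u k - c) @[k --> \oo] -->
         (1 + t) * L + (1 + t^-1) * 0.
    by apply: cvgD; apply: cvgMl_tmp.
  rewrite mulr0 addr0 => /cvgr_to_ge; apply.
  apply: nearW => k.
  have y := form_young (u k - o) (c - u k) t0.
  have -> : N (c - o) = N (u k - o) + 2 * B (u k - o) (c - u k) + N (c - u k).
    rewrite !formsE (form_sym Bform c (u k)) (form_sym Bform o (u k)).
    rewrite (form_sym Bform o c).
    by ring.
  rewrite [N (u k - c)]form_distC.
  have : (1 + t) * N (u k - o) <= (1 + t) * a k by rewrite ler_wpM2l//; lra.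
  by lra.
have L0 : 0 <= L.
  apply: cvgr_to_ge aL _; apply: nearW => k; apply: le_trans (ua k).
  exact: form_ge0 Bform _.
apply/ler_addgt0Pr => e e0.
(* t := e / (L + 1) makes the excess t L at most e. *)
have d0 : 0 < e / (L + 1) by rewrite divr_gt0//; lra.
apply: le_trans (key _ d0) _.
rewrite mulrDl mul1r lerD2l mulrAC ler_pdivrMr; last by lra.
by rewrite ler_wpM2l ?(ltW e0)//; lra.
Qed.

Definition closed_hull (A : set E) : set E :=
  [set q | forall C, form_closed C -> is_convex C -> A `<=` C -> C q].

Definition tail_hull (u : nat -> E) m :=
  closed_hull [set u j | j in [set j | (m <= j)%N]].

Lemma tail_hull_mem u m j : (m <= j)%N -> tail_hull u m (u j).
Proof. by move=> mj C _ _; apply; exists j. Qed.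

Lemma tail_hullS u m j : (m <= j)%N -> tail_hull u j `<=` tail_hull u m.
Proof.
move=> mj q qj C clC cvC mC; apply: qj => // _ [k /= jk <-]; apply: mC.
by exists k => //=; exact: leq_trans jk.
Qed.

Lemma tail_hull_mid u m q r : tail_hull u m q -> tail_hull u m r ->
  tail_hull u m (q + 2^-1 *: (r - q)).
Proof.
move=> qm rm C clC cvC mC; apply: (cvC).
- by rewrite invr_ge0 invf_le1 ?ler0n ?ltr0n// ler1n.
- exact: qm.
- exact: rm.
Qed.

(** This replaces the extraction of a weakly convergent subsequence.  The squared
    distances d from o to the hulls of the tails increase to a limit L, and
    points of the hulls realizing them up to a null error form a Cauchy
    sequence, because midpoints stay in the hull.  If the limit c is at least as
    far from o as every u k, then the midpoint of u k and c, whose squared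
    distance to o is at least that of the k-th hull, forces
    N (u k - c) <= 4 (L - d k). *)
Lemma hull_limit u o D : form_complete -> (forall k, N (u k - o) <= D) ->
  exists c, (forall m, tail_hull u m c) /\
    ((forall k, N (u k - o) <= N (c - o)) -> form_cvg u c).
Proof.
move=> complete uD.
pose S m := [set N (q - o) | q in tail_hull u m].
pose d m := inf (S m).
have S0 m : has_inf (S m).
  split; first by exists (N (u m - o)), (u m) => //; exact: tail_hull_mem.
  by exists 0 => _ [q _ <-]; exact: form_ge0.
have dle m q : tail_hull u m q -> d m <= N (q - o).
  by move=> qm; apply: ge_inf; [exact: (S0 m).2|exists q].
have d_homo : {homo d : m j / (m <= j)%N >-> m <= j}.
  move=> m j mj; apply: lb_le_inf; first exact: (S0 j).1.
  by move=> _ [q qj <-]; apply: dle; exact: tail_hullS qj.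
have d_cvg : cvgn d.
  apply: nondecreasing_is_cvgn => //; exists D => _ [k _ <-].
  by apply: le_trans (uD k); apply: dle; exact: tail_hull_mem.
pose L : R := limn d.
have dL m : d m <= L by exact: nondecreasing_cvgn_le.
have [h [h0 h_homo h_cvg]] : exists h : nat -> R, [/\ forall k, 0 < h k,
    {homo h : m j / (m <= j)%N >-> j <= m} & h k @[k --> \oo] --> (0 : R)].
  exists (fun k => k.+1%:R^-1); split => [k|m j mj|]; last exact: cvg_harmonic.
    by rewrite invr_gt0.
  by rewrite lef_pV2 ?posrE// ler_nat.
have /choice[e eP] : forall m, exists q, tail_hull u m q /\ N (q - o) <= d m + h m.
  move=> m; have [_ [q qm <-] qd] := inf_adherent (h0 m) (S0 m).
  by exists q; split => //; exact: ltW.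
have Ld0 : L - d k @[k --> \oo] --> (0 : R).
  by rewrite -(subrr L); apply: cvgB => //; exact: cvg_cst.
have [] := complete e (fun m => 2 * (L - d m) + 4 * h m).
- have := cvgD (cvgMl_tmp (a := 2) Ld0) (cvgMl_tmp (a := 4) h_cvg).
  by rewrite !mulr0 addr0; apply.
- move=> m j mj /=; rewrite (form_parallelogram (e m) (e j) o).
  have [em emd] := eP m; have [ej ejd] := eP j.
  have := dle m _ (tail_hull_mid em (tail_hullS mj ej)).
  by have := dL j; have := h_homo _ _ mj; lra.
move=> c ec; exists c; have cm m : tail_hull u m c.
  move=> C clC cvC mC; apply: (clC (fun k => e (k + m)%N)).
    by move=> k; apply: (tail_hullS (leq_addl k m) (eP _).1) => //.
  by move: ec; rewrite /form_cvg -(cvg_shiftn m).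
split => // uc.
have cL : N (c - o) <= L.
  apply: (@form_norm_lim e _ c o) ec _ _ => //; last by move=> k; exact: (eP k).2.
  by rewrite -(addr0 L); apply: cvgD.
have lim0 : 4 * (L - d k) @[k --> \oo] --> (0 : R).
  by rewrite -(mulr0 4); apply: cvgMl_tmp.
apply: null_le lim0 => k; rewrite form_ge0//= (form_parallelogram _ _ o).
have := dle k _ (tail_hull_mid (tail_hull_mem (u := u) (leqnn k)) (cm k)).
by have := uc k; lra.
Qed.

(** The variational inequality of the projection: moving from q towards r by a
    small t would otherwise decrease the distance to o. *)
Lemma form_projection_le0 A o q r : is_convex A -> form_projection A o q ->
  A r -> B (o - q) (r - q) <= 0.
Proof.
move=> cvA [qA qmin] rA; rewrite leNgt; apply/negP => b0.
set b := B (o - q) (r - q) in b0; have n0 := form_ge0 Bform (r - q).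
(* A step with t N (r - q) <= b, for which the first-order gain 2 t b exceeds
   the second-order loss t^2 N (r - q). *)
set t := b / (b + N (r - q)).
have bn0 : 0 < b + N (r - q) by rewrite ltr_pwDl.
have t0 : 0 < t by exact: divr_gt0.
have t1 : t <= 1 by rewrite ler_pdivrMr//; lra.
have := qmin _ (cvA q r t ltac:(by rewrite (ltW t0)) qA rA).
have -> : o - (q + t *: (r - q)) = (o - q) - t *: (r - q) by rewrite opprD addrA.
rewrite (form_sqrB (o - q)) !formZr formZl -/b.
have tn : t * N (r - q) <= b.
  by rewrite /t mulrAC ler_pdivrMr// mulrDr lerDr mulr_ge0// ltW.
have : t * (t * N (r - q)) <= t * b by rewrite ler_wpM2l// ltW.
have : 0 < t * b by rewrite mulr_gt0.
by lra.
Qed.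

Section Haugazeau.
Variables (p : nat -> E) (H : nat -> set E) (S : set E).
Let W k := [set q | B (p 0%N - p k) (q - p k) <= 0].
Hypothesis H_convex : forall k, is_convex (H k).
Hypothesis S_sub : forall k, S `<=` H k.
Hypothesis S_neq0 : S !=set0.
Hypothesis p_next : forall k, form_projection (H k `&` W k) (p 0%N) (p k.+1).

(** The choice of W k is exactly the half-space given by the variational
    inequality of the projection onto the previous H k `&` W k, so S is never
    cut off. *)
Lemma haugazeau_sub k : S `<=` W k.
Proof.
elim: k => [|k IH] q Sq; first by rewrite /W /= subrr form0l.
apply: form_projection_le0 (p_next k) _; last by split; [exact: S_sub|exact: IH].
move=> u v t /andP[t0 t1] [uH uW] [vH vW]; split.
  by apply: H_convex => //; rewrite t0.
rewrite /W /= in uW vW *.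
have -> : u + t *: (v - u) - p k = (1 - t) *: (u - p k) + t *: (v - p k).
  rewrite scalerBl scale1r -[RHS]addrA [- _ + _]addrC -scalerBr.
  by rewrite (opprB u) addrA subrK addrAC.
rewrite formDr !formZr.
have : (1 - t) * B (p 0%N - p k) (u - p k) <= 0 by rewrite mulr_ge0_le0// subr_ge0.
have : t * B (p 0%N - p k) (v - p k) <= 0 by rewrite mulr_ge0_le0.
by lra.
Qed.

Lemma haugazeau_dist k q : S q -> N (p 0%N - p k) <= N (p 0%N - q).
Proof.
case: k => [|k] Sq; first by rewrite subrr form0l form_ge0.
by apply: (p_next k).2; split; [exact: S_sub|exact: haugazeau_sub].
Qed.

(** Membership of p k.+1 in W k gives, by Pythagoras, a bound of the squared
    step by the increase of the squared distance to p 0, and these increases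
    telescope in a bounded sequence. *)
Lemma haugazeau_step : N (p k.+1 - p k) @[k --> \oo] --> (0 : R).
Proof.
have [q Sq] := S_neq0.
pose a k := N (p 0%N - p k).
have aS k : N (p k.+1 - p k) <= a k.+1 - a k.
  have : B (p 0%N - p k) (p k.+1 - p k) <= 0 by have [[_ +] _] := p_next k.
  rewrite /a; have -> : p 0%N - p k.+1 = (p 0%N - p k) - (p k.+1 - p k).
    by rewrite (opprB (p k.+1)) addrA subrK.
  by rewrite (form_sqrB (p 0%N - p k)); lra.
have a_cvg : cvgn a.
  apply: nondecreasing_is_cvgn.
    apply/nondecreasing_seqP => k; rewrite -subr_ge0; apply: le_trans (aS k).
    exact: form_ge0.
  by exists (N (p 0%N - q)) => _ [k _ <-]; exact: haugazeau_dist.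
apply: (@null_le _ _ (fun k => a k.+1 - a k)).
  by move=> k; rewrite form_ge0//= aS.
rewrite -(subrr (limn a)); apply: cvgB => //.
by rewrite (cvg_shiftS a).
Qed.

(** The hypothesis on c is the usual requirement that weak cluster points of
    the iterates lie in S, stated through closed convex sets. *)
Lemma haugazeau_cvg : form_complete ->
  (forall c, (forall A, form_closed A -> is_convex A ->
    (\forall k \near \oo, A (p k)) -> A c) -> S c) ->
  exists c, form_projection S (p 0%N) c /\ form_cvg p c.
Proof.
move=> complete cluster; have [q Sq] := S_neq0.
have dist k r : S r -> N (p k - p 0%N) <= N (r - p 0%N).
  by move=> Sr; rewrite !(form_distC _ (p 0%N)) haugazeau_dist.
have [c [cT cP]] := hull_limit complete (fun k => dist k q Sq).
have Sc : S c.
  apply: cluster => A clA cvA [m _ mA]; apply: (cT m) => // _ [k /= mk <-].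
  exact: mA.
have pc : form_cvg p c by apply: cP => k; exact: dist.
exists c; split=> //; split=> // r Sr.
rewrite form_distC; apply: (form_norm_lim pc (@cvg_cst _ _ _ _ _)).
by move=> k; rewrite (form_distC (p 0%N)) dist.
Qed.
End Haugazeau.
End PreHilbert.

(** * Null and bounded sequences *)

Section SequenceLimits.
Variable R : realType.

Lemma cvg_sumr (V : normedModType R) (I : finType) (P : pred I)
    (f : nat -> I -> V) (a : I -> V) :
  (forall i, P i -> f k i @[k --> \oo] --> a i) ->
  \sum_(i | P i) f k i @[k --> \oo] --> \sum_(i | P i) a i.
Proof. by move=> fa; apply: cvg_big => //; exact: add_continuous. Qed.

Lemma null_sum (I : finType) (P : pred I) (f : nat -> I -> R) :
  (forall i, P i -> f k i @[k --> \oo] --> (0 : R)) ->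
  \sum_(i | P i) f k i @[k --> \oo] --> (0 : R).
Proof. by move=> /cvg_sumr; rewrite big1_eq. Qed.

Lemma norm_null (V : normedModType R) (u : nat -> V) :
  u k @[k --> \oo] --> (0 : V) -> `|u k| @[k --> \oo] --> (0 : R).
Proof. by move=> /cvg_norm; rewrite normr0. Qed.

Lemma sqr_null (u : nat -> R) :
  u k ^+ 2 @[k --> \oo] --> (0 : R) -> u k @[k --> \oo] --> (0 : R).
Proof.
move=> u0; have : Num.sqrt (u k ^+ 2) @[k --> \oo] --> Num.sqrt (0 : R).
  by apply: continuous_cvg => //; exact: sqrt_continuous.
rewrite sqrtr0; under eq_fun do rewrite sqrtr_sqr.
by move/norm_cvg0P.
Qed.

Lemma norm_sqr_null (V : normedModType R) (u : nat -> V) :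
  `|u k| ^+ 2 @[k --> \oo] --> (0 : R) <-> u k @[k --> \oo] --> (0 : V).
Proof.
split=> [/sqr_null/norm_cvg0P//|/norm_null u0].
by have := cvgM u0 u0; rewrite mulr0; apply.
Qed.

Lemma cvg_of_sub_null (V : normedModType R) (u v : nat -> V) (a : V) :
  u k - v k @[k --> \oo] --> (0 : V) -> v k @[k --> \oo] --> (a : V) ->
  u k @[k --> \oo] --> (a : V).
Proof. by move=> uv va; apply: cvg_sub0 va. Qed.

Definition bounded_seq (V : normedModType R) (u : nat -> V) :=
  exists M, forall k, `|u k| <= M.

Lemma bounded_null (u v : nat -> R) : bounded_seq u ->
  v k @[k --> \oo] --> (0 : R) -> `|u k| * `|v k| @[k --> \oo] --> (0 : R).
Proof.
move=> [M uM] /norm_null v0; apply: (@null_le _ _ (fun k => M * `|v k|)).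
  by move=> k; rewrite mulr_ge0//= ler_wpM2r.
by rewrite -(mulr0 M); apply: cvgMl_tmp.
Qed.

Lemma bounded_norm (V : normedModType R) (u : nat -> V) :
  bounded_seq u -> bounded_seq (fun k => `|u k|).
Proof. by move=> [M uM]; exists M => k; rewrite normr_id. Qed.

Lemma bounded_seqD (V : normedModType R) (u v : nat -> V) :
  bounded_seq u -> bounded_seq v -> bounded_seq (fun k => u k + v k).
Proof.
by move=> [M uM] [M' vM]; exists (M + M') => k; rewrite (le_trans (ler_normD _ _))// lerD.
Qed.

Lemma bounded_seq_sum (V : normedModType R) (I : finType) (P : pred I)
    (f : nat -> I -> V) : (forall i, bounded_seq (fun k => f k i)) ->
  bounded_seq (fun k => \sum_(i | P i) f k i).
Proof.
move=> /choice[M fM]; exists (\sum_(i | P i) M i) => k.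
by apply: le_trans (ler_norm_sum _ _ _) _; apply: ler_sum => i _; exact: fM.
Qed.

Lemma bounded_seq_cst (V : normedModType R) (a : V) : bounded_seq (fun=> a).
Proof. by exists `|a|. Qed.

Lemma bounded_scale_null (V : normedModType R) (a : nat -> R) (v : nat -> V) :
  bounded_seq a -> v k @[k --> \oo] --> (0 : V) -> a k *: v k @[k --> \oo] --> (0 : V).
Proof.
move=> ba v0; apply/norm_cvg0P; under eq_fun do rewrite normrZ -(normr_id (v _)).
by apply: bounded_null => //; exact: norm_null.
Qed.

Lemma null_scale_bounded (V : normedModType R) (a : nat -> R) (v : nat -> V) :
  a k @[k --> \oo] --> (0 : R) -> bounded_seq v -> a k *: v k @[k --> \oo] --> (0 : V).
Proof.
move=> a0 bv; apply/norm_cvg0P; under eq_fun do rewrite normrZ mulrC -(normr_id (v _)).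
by apply: bounded_null => //; exact: bounded_norm.
Qed.

Lemma cauchy_modulus (V : completeNormedModType R) (u : nat -> V) (eta : nat -> R) :
  eta k @[k --> \oo] --> (0 : R) ->
  (forall m j, (m <= j)%N -> `|u m - u j| ^+ 2 <= eta m) -> cvgn u.
Proof.
move=> eta0 ueta; apply: cauchy_cvg; apply: cauchy_exP => e e0.
have /cvgr0Pnorm_lt/(_ _ (exprn_gt0 2 e0))[m _ /(_ m (leqnn m)) /= me] := eta0.
exists (u m); exists m => // j /= mj.
rewrite -ball_normE /= -(@ltr_pXn2r _ 2)// ?nnegrE ?(ltW e0)//.
by apply: le_lt_trans (ueta _ _ mj) _; exact: le_lt_trans (ler_norm _) me.
Qed.

Lemma square_summable_null (b : nat -> R) :
  (\sum_(0 <= k <oo) (b k ^+ 2)%:E < +oo)%E -> b k @[k --> \oo] --> (0 : R).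
Proof.
move=> h; apply: sqr_null.
have /cvg_series_cvg_0 := @nnseries_is_cvg R (fun k => b k ^+ 2) (fun k => sqr_ge0 _) h.
exact.
Qed.

End SequenceLimits.

(** * Hilbert spaces and adjoints *)

Lemma linear_additive (R : realType) (U V : lmodType R) (f : U -> V) :
  linear f -> forall u v, f (u - v) = f u - f v.
Proof. by move=> lf u v; rewrite addrC -scaleN1r lf scaleN1r addrC. Qed.

Section HilbertSpace.
Variables (R : realType) (V W : hilbertType R).

Lemma inner_form : prehilbert_form (fun u v : V => '[u, v]).
Proof.
split=> [u v|w a u v|u] /=.
- by rewrite hermC expr0 mul1r.
- exact: linearPl.
- have [->|u0] := eqVneq u 0; first by rewrite linear0l.
  by rewrite ltW//; exact: neq0_dnorm_gt0.
Qed.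

Lemma norm_sqr (u : V) : `|u| ^+ 2 = '[u, u].
Proof. by rewrite norm_inner sqr_sqrtr// (form_ge0 inner_form). Qed.

Lemma norm_sqrD (u v : V) : `|u + v| ^+ 2 = `|u| ^+ 2 + 2 * '[u, v] + `|v| ^+ 2.
Proof.
rewrite !norm_sqr !(formsE inner_form) (form_sym inner_form v u).
by ring.
Qed.

(** Cauchy-Schwarz read off from the triangle inequality of the norm, which is
    part of the normed-module structure. *)
Lemma inner_le (u v : V) : '[u, v] <= `|u| * `|v|.
Proof.
have : `|u + v| ^+ 2 <= (`|u| + `|v|) ^+ 2.
  by rewrite lerXn2r ?nnegrE ?addr_ge0// ler_normD.
by rewrite norm_sqrD; nra.
Qed.

Lemma norm_inner_le (u v : V) : `| '[u, v] | <= `|u| * `|v|.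
Proof.
rewrite ler_norml inner_le andbT lerNl -(formNl inner_form).
by rewrite (le_trans (inner_le _ _))// normrN.
Qed.

Lemma inner_young t (u v : V) : 0 < t -> 2 * '[u, v] <= t * `|u| ^+ 2 + t^-1 * `|v| ^+ 2.
Proof. by move=> t0; rewrite !norm_sqr (form_young inner_form). Qed.

Lemma inner_eq0 (u : V) : (forall x, '[x, u] = 0) -> u = 0.
Proof. by move=> /(_ u) u0; apply/eqP; rewrite -normr_eq0 -sqrf_eq0 norm_sqr u0. Qed.

(** By polarization, continuity of the norm is enough. *)
Lemma inner_cvg (u v : nat -> V) (a b : V) :
  u k @[k --> \oo] --> a -> v k @[k --> \oo] --> b ->
  '[u k, v k] @[k --> \oo] --> '[a, b].
Proof.
have polar (x y : V) : '[x, y] = 2^-1 * (`|x + y| * `|x + y| - `|x| * `|x| - `|y| * `|y|).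
  by have := norm_sqrD x y; rewrite !expr2 => ->; field.
move=> ua vb; rewrite polar; under eq_fun do rewrite polar.
have na : `|u k| @[k --> \oo] --> `|a| by exact: cvg_norm.
have nb : `|v k| @[k --> \oo] --> `|b| by exact: cvg_norm.
have nab : `|u k + v k| @[k --> \oo] --> `|a + b| by apply: cvg_norm; exact: cvgD.
apply: cvgMl_tmp.
exact: cvgB (cvgB (cvgM nab nab) (cvgM na na)) (cvgM nb nb).
Qed.

Lemma inner_null (u v : nat -> V) : bounded_seq u -> v k @[k --> \oo] --> (0 : V) ->
  '[u k, v k] @[k --> \oo] --> (0 : R).
Proof.
move=> bu /norm_null v0; apply/norm_cvg0P.
apply: null_le (bounded_null (bounded_norm bu) v0) => k.
by rewrite !normr_id normr_ge0 norm_inner_le.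
Qed.

Lemma bounded_op_le (f : V -> W) : bounded_op f ->
  exists2 M, 0 <= M & forall x, `|f x| <= M * `|x|.
Proof.
move=> [M fM]; exists `|M| => // x.
by apply: le_trans (fM x) _; rewrite ler_wpM2r// ler_norm.
Qed.

Lemma bounded_op_null (f : V -> W) (u : nat -> V) : bounded_op f ->
  u k @[k --> \oo] --> (0 : V) -> f (u k) @[k --> \oo] --> (0 : W).
Proof.
move=> /bounded_op_le[M M0 fM] /norm_null u0; apply/norm_cvg0P.
apply: (@null_le _ _ (fun k => M * `|u k|)); first by move=> k; rewrite normr_ge0 fM.
by rewrite -(mulr0 M); apply: cvgMl_tmp.
Qed.

Lemma bounded_op_cvg (f : V -> W) (u : nat -> V) a : linear f -> bounded_op f ->
  u k @[k --> \oo] --> a -> f (u k) @[k --> \oo] --> f a.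
Proof.
move=> lf bf /subr_cvg0 ua; apply/subr_cvg0.
under eq_fun do rewrite -linear_additive//.
exact: bounded_op_null.
Qed.

Lemma bounded_op_seq (f : V -> W) (u : nat -> V) : bounded_op f ->
  bounded_seq u -> bounded_seq (fun k => f (u k)).
Proof.
move=> /bounded_op_le[M M0 fM] [D uD]; exists (M * D) => k.
by apply: le_trans (fM _) _; rewrite ler_wpM2l.
Qed.

End HilbertSpace.

Local Notation innerDl := (formDl (inner_form _)).
Local Notation innerDr := (formDr (inner_form _)).
Local Notation innerBl := (formBl (inner_form _)).
Local Notation innerBr := (formBr (inner_form _)).
Local Notation innerNl := (formNl (inner_form _)).
Local Notation innerNr := (formNr (inner_form _)).
Local Notation innerZl := (formZl (inner_form _)).
Local Notation innerZr := (formZr (inner_form _)).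
Local Notation inner_sym := (form_sym (inner_form _)).
Local Notation inner_ge0 := (form_ge0 (inner_form _)).

Section Adjoint.
Variables (R : realType) (V W : hilbertType R) (f : W -> V) (g : V -> W).
Hypothesis fg : is_adjoint f g.

Lemma adjoint_linear : linear g.
Proof.
move=> a u v; apply/eqP; rewrite -subr_eq0; apply/eqP; apply: inner_eq0 => x.
by rewrite innerBr innerDr innerZr -!fg innerDr innerZr subrr.
Qed.

(** From |g u|^2 = <f (g u), u> <= M |g u| |u|, divided by |g u|. *)
Lemma adjoint_bounded : bounded_op f -> bounded_op g.
Proof.
move=> /bounded_op_le[M M0 fM]; exists M => u.
have [->|gu0] := eqVneq (g u) 0; first by rewrite normr0 mulr_ge0.
have gu : 0 < `|g u| by rewrite normr_gt0.
rewrite -(ler_pM2l gu) -expr2 norm_sqr -fg (le_trans (inner_le _ _))//.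
by rewrite mulrCA mulrA ler_wpM2r.
Qed.
End Adjoint.

(** * The product space *)

(** A name for the type of points, on which the module structure is put. *)
Definition prod_space (R : realType) (n : nat) (H : 'I_n.+2 -> hilbertType R) : Type :=
  forall i, H i.

Section ProductModule.
Variables (R : realType) (n : nat) (H : 'I_n.+2 -> hilbertType R).
Local Notation E := (prod_space H).

HB.instance Definition _ := gen_eqMixin E.
HB.instance Definition _ := gen_choiceMixin E.

Definition prod_add (p q : E) : E := fun i => p i + q i.
Definition prod_opp (p : E) : E := fun i => - p i.
Definition prod_zero : E := fun i => 0.
Definition prod_scale (a : R) (p : E) : E := fun i => a *: p i.

Fact prod_addA : associative prod_add.
Proof. by move=> p q r; apply: functional_extensionality_dep => i; exact: addrA. Qed.
Fact prod_addC : commutative prod_add.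
Proof. by move=> p q; apply: functional_extensionality_dep => i; exact: addrC. Qed.
Fact prod_add0 : left_id prod_zero prod_add.
Proof. by move=> p; apply: functional_extensionality_dep => i; exact: add0r. Qed.
Fact prod_addN : left_inverse prod_zero prod_opp prod_add.
Proof. by move=> p; apply: functional_extensionality_dep => i; exact: addNr. Qed.

HB.instance Definition _ :=
  GRing.isZmodule.Build E prod_addA prod_addC prod_add0 prod_addN.

Fact prod_scaleA a b p : prod_scale a (prod_scale b p) = prod_scale (a * b) p.
Proof. by apply: functional_extensionality_dep => i; exact: scalerA. Qed.
Fact prod_scale1 : left_id 1 prod_scale.
Proof. by move=> p; apply: functional_extensionality_dep => i; exact: scale1r. Qed.
Fact prod_scaleDr : right_distributive prod_scale +%R.
Proof. by move=> a p q; apply: functional_extensionality_dep => i; exact: scalerDr. Qed.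
Fact prod_scaleDl p : {morph prod_scale^~ p : a b / a + b}.
Proof. by move=> a b; apply: functional_extensionality_dep => i; exact: scalerDl. Qed.

HB.instance Definition _ :=
  GRing.Zmodule_isLmodule.Build R E prod_scaleA prod_scale1 prod_scaleDr prod_scaleDl.
End ProductModule.

Section ProductForm.
Variables (R : realType) (n : nat) (H : 'I_n.+2 -> hilbertType R).
Local Notation E := (prod_space H).
Variables (gamma : R) (gamma0 : 0 < gamma).
Let B : E -> E -> R := inner_gamma gamma.

Lemma inner_gamma_form : prehilbert_form B.
Proof.
split=> [u v|w a u v|u]; rewrite /B /inner_gamma.
- rewrite inner_sym; congr (_ + _).
  by apply: eq_bigr => i _; exact: inner_sym _ _.
- have expand i : '[(a *: u + v) i, w i] = a * '[u i, w i] + '[v i, w i].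
    exact: form_linear (inner_form _) _ _ _ _.
  rewrite expand (eq_bigr _ (fun i _ => expand i)) big_split /= -mulr_sumr.
  by ring.
- rewrite addr_ge0 ?mulr_ge0 ?(ltW gamma0) ?inner_ge0//.
  by apply: sumr_ge0 => i _; exact: inner_ge0 _.
Qed.

(** The weight only rescales the first block, so convergence, boundedness and
    completeness for the weighted form reduce to the blocks. *)
Lemma sqr_component_le : exists2 C, 0 < C & forall (p : E) i, `|p i| ^+ 2 <= C * B p p.
Proof.
exists (1 + gamma^-1); first by rewrite addr_gt0// invr_gt0.
move=> p i.
have first0 : 0 <= gamma * '[p ord0, p ord0].
  by rewrite mulr_ge0 ?(ltW gamma0) ?inner_ge0.
have rest0 (P : pred 'I_n.+2) : 0 <= \sum_(i | P i) '[p i, p i].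
  by apply: sumr_ge0 => j _; exact: inner_ge0 _.
have inv0 : 0 <= gamma^-1 by rewrite invr_ge0 ltW.
rewrite norm_sqr /B /inner_gamma mulrDl mul1r.
have [->|i0] := eqVneq i ord0.
  rewrite [X in _ <= _ + X]mulrDr mulrA mulVf ?gt_eqF// mul1r.
  have := mulr_ge0 inv0 (rest0 (fun i => i != ord0)).
  by have := rest0 (fun i => i != ord0); lra.
rewrite (bigD1 i) //=.
set s := \sum_(_ | _) _; have s0 : 0 <= s by exact: rest0.
have pi0 : 0 <= '[p i, p i] by exact: inner_ge0 _.
have : 0 <= gamma^-1 * (gamma * '[p ord0, p ord0] + ('[p i, p i] + s)).
  by rewrite mulr_ge0// !addr_ge0.
by lra.
Qed.

Lemma inner_gamma_nullP (u : nat -> E) :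
  B (u k) (u k) @[k --> \oo] --> (0 : R) <-> forall i, u k i @[k --> \oo] --> (0 : H i).
Proof.
split=> [u0 i|u0].
  have [C C0 CB] := sqr_component_le.
  apply/norm_sqr_null; apply: (@null_le _ _ (fun k => C * B (u k) (u k))).
    by move=> k; rewrite exprn_ge0//= CB.
  by rewrite -(mulr0 C); apply: cvgMl_tmp.
have inner0 i : '[u k i, u k i] @[k --> \oo] --> (0 : R).
  by rewrite -(linear0l (@inner R (H i)) 0); exact: inner_cvg.
have := cvgD (cvgMl_tmp (a := gamma) (inner0 ord0))
  (null_sum (P := fun i => i != ord0) (fun i _ => inner0 i)).
by rewrite mulr0 addr0; apply.
Qed.

Lemma inner_gamma_cvgP (u : nat -> E) (c : E) :
  form_cvg B u c <-> forall i, u k i @[k --> \oo] --> c i.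
Proof.
rewrite /form_cvg (inner_gamma_nullP (fun k => u k - c)).
by split=> uc i; apply/subr_cvg0; exact: uc.
Qed.

Lemma inner_gamma_complete : form_complete B.
Proof.
move=> u eta eta0 ueta; have [C C0 CB] := sqr_component_le.
have ucvg i : cvgn (fun k => u k i).
  apply: (@cauchy_modulus _ _ _ (fun k => C * eta k)).
    by rewrite -(mulr0 C); apply: cvgMl_tmp.
  move=> m j mj; apply: le_trans (CB (u m - u j) i) _.
  by rewrite ler_pM2l// ueta.
exists (fun i => limn (fun k => u k i)).
by apply/inner_gamma_cvgP => i; exact: ucvg.
Qed.

Lemma is_projectionP (C : set E) (p q : E) :
  is_projection gamma C p q <-> form_projection B C p q.
Proof.
split=> -[Cq qmin]; split=> // r Cr; last by apply: ler_wsqrtr; exact: qmin.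
have := qmin r Cr.
rewrite /norm_gamma ler_sqrt//; exact: form_ge0 inner_gamma_form _.
Qed.

Lemma inner_gamma_bounded (u : nat -> E) (c : E) D :
  (forall k, B (c - u k) (c - u k) <= D) -> forall i, bounded_seq (fun k => u k i).
Proof.
move=> uD i; have [C C0 CB] := sqr_component_le.
exists (`|c i| + (1 + C * D)) => k.
have sq : `|c i - u k i| ^+ 2 <= C * D.
  by apply: le_trans (CB (c - u k) i) _; rewrite ler_pM2l.
have -> : u k i = c i - (c i - u k i) by rewrite opprB addrCA subrr addr0.
by apply: le_trans (ler_normB _ _) _; rewrite lerD2l; nra.
Qed.

End ProductForm.

(** * Extended solutions as an intersection of half-spaces *)

Section MaximalMonotone.
Variables (R : realType) (V : hilbertType R) (T : V -> set V).
Hypothesis Tmax : maximal_monotone T.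

(** Otherwise the graph of T enlarged by (x, u) would still be monotone. *)
Lemma maximal_monotone_witness x u : ~ T x u ->
  exists a b, T a b /\ '[x - a, u - b] < 0.
Proof.
move=> nTxu; apply: contrapT => none.
have mono_xu a b : T a b -> 0 <= '[x - a, u - b].
  by move=> Tab; rewrite leNgt; apply/negP => lt0; apply: none; exists a, b.
have [Tmono Tsup] := Tmax.
pose S a b := T a b \/ (a = x /\ b = u).
apply: nTxu; rewrite -(Tsup S); last 1 first.
- by move=> a b Tab; left.
- by right.
move=> a c b d [Tab|[-> ->]] [Tcd|[-> ->]]; first exact: Tmono.
- by rewrite -(opprB x) -(opprB u) innerNl innerNr opprK mono_xu.
- exact: mono_xu.
- by rewrite !subrr inner_ge0.
Qed.
End MaximalMonotone.

Section Separators.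
Variables (R : realType) (n : nat) (H : 'I_n.+2 -> hilbertType R).
Variables (G : forall i, {linear H ord0 -> H i}) (Gs : forall i, H i -> H ord0).
Hypothesis G_adjoint : forall i, is_adjoint (G i) (@Gs i).
Hypothesis G_bounded : forall i, bounded_op (G i).
Hypothesis G_last : forall z, G ord0 z = z.
Local Notation E := (prod_space H).

Lemma wpart_last (q : E) : wpart Gs q ord0 = wlast Gs q.
Proof. exact: dfwithin. Qed.

Lemma wpart_other (q : E) i : i != ord0 -> wpart Gs q i = q i.
Proof. by move=> i0; apply: dfwithout; rewrite eq_sym. Qed.

(** G_N is the identity, so its adjoint is the identity too. *)
Lemma Gs_last u : @Gs ord0 u = u.
Proof.
apply/eqP; rewrite -subr_eq0; apply/eqP; apply: inner_eq0 => x.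
by rewrite innerBr -G_adjoint G_last subrr.
Qed.

(** The definition of w_N is made for this identity. *)
Lemma wpart_sum (q : E) : \sum_i Gs (wpart Gs q i) = 0.
Proof.
rewrite (bigD1 ord0)//= wpart_last Gs_last (eq_bigr (fun i => Gs (q i))).
  by rewrite /wlast addNr.
by move=> i i0; rewrite wpart_other.
Qed.

Lemma wpart_linear i : linear (fun q : E => wpart Gs q i).
Proof.
move=> a p q; have [->|i0] := eqVneq i ord0; last by rewrite !wpart_other.
rewrite !wpart_last /wlast scalerN -opprD scaler_sumr -big_split /=.
by congr (- _); apply: eq_bigr => j _; exact: (adjoint_linear (@G_adjoint j)).
Qed.

Lemma wpart_cvg (u : nat -> E) (c : E) : (forall i, u k i @[k --> \oo] --> c i) ->
  forall i, wpart Gs (u k) i @[k --> \oo] --> wpart Gs c i.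
Proof.
move=> uc i; have [->|i0] := eqVneq i ord0.
  rewrite wpart_last; under eq_fun do rewrite wpart_last.
  apply: cvgN; apply: cvg_sumr => j _.
  apply: bounded_op_cvg => //; first exact: adjoint_linear (@G_adjoint j).
  exact: adjoint_bounded (@G_adjoint j) (G_bounded j).
rewrite wpart_other//; under eq_fun do rewrite wpart_other//.
exact: uc.
Qed.

Lemma wpart_sub_null (u v : nat -> E) :
  (forall i, u k i - v k i @[k --> \oo] --> (0 : H i)) ->
  forall i, wpart Gs (u k) i - wpart Gs (v k) i @[k --> \oo] --> (0 : H i).
Proof.
move=> uv i; have lin := linear_additive (wpart_linear i).
have w0 : wpart Gs (0 : E) i = 0 by rewrite -(subrr (0 : E)) lin subrr.
under eq_fun do rewrite -lin.
by rewrite -w0; apply: wpart_cvg => j; exact: uv.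
Qed.

Lemma wpart_bounded (u : nat -> E) : (forall i, bounded_seq (fun k => u k i)) ->
  forall i, bounded_seq (fun k => wpart Gs (u k) i).
Proof.
move=> ub i; have [->|i0] := eqVneq i ord0.
  have [M uM] : bounded_seq (fun k => \sum_(j | j != ord0) Gs (u k j)).
    apply: bounded_seq_sum => j; apply: bounded_op_seq => //.
    exact: adjoint_bounded (@G_adjoint j) (G_bounded j).
  by exists M => k; rewrite wpart_last normrN.
by have [M uM] := ub i; exists M => k; rewrite wpart_other.
Qed.

(** The cut associated with points (a_i, b_i); with a = x^k and b = y^k it is
    phi_k up to the sum of the eps_i^k. *)
Definition separator (a b q : E) : R :=
  \sum_i '[G i (q ord0) - a i, b i - wpart Gs q i].

(** The only terms that are quadratic in q are the <G_i z, w_i>, whose sum is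
    <z, sum_i G_i^* w_i> = 0. *)
Lemma separatorE a b q : separator a b q =
  \sum_i ('[G i (q ord0), b i] + '[a i, wpart Gs q i]) - \sum_i '[a i, b i].
Proof.
have cross : \sum_i '[G i (q ord0), wpart Gs q i] = 0.
  rewrite (eq_bigr (fun i => '[q ord0, Gs (wpart Gs q i)])) => [|i _].
    by rewrite -linear_sumr wpart_sum linear0r.
  by rewrite G_adjoint.
rewrite /separator (eq_bigr (fun i => '[G i (q ord0), b i] + '[a i, wpart Gs q i]
  - '[a i, b i] - '[G i (q ord0), wpart Gs q i])) => [|i _].
  by rewrite !sumrB cross subr0.
by rewrite innerBl !innerBr; ring.
Qed.

Lemma separator_affine a b t p q :
  separator a b (p + t *: (q - p)) = (1 - t) * separator a b p + t * separator a b q.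
Proof.
have lin i (f : E -> H i) : linear f -> f (p + t *: (q - p)) = (1 - t) *: f p + t *: f q.
  move=> lf; rewrite [p + _]addrC lf linear_additive//.
  by rewrite scalerBl scalerBr scale1r [LHS]addrC addrA addrAC.
rewrite !separatorE.
rewrite (eq_bigr (fun i => (1 - t) * ('[G i (p ord0), b i] + '[a i, wpart Gs p i])
  + t * ('[G i (q ord0), b i] + '[a i, wpart Gs q i]))) => [|i _].
  by rewrite big_split /= -!mulr_sumr; ring.
rewrite (lin _ _ (wpart_linear i)) (lin i (fun q => G i (q ord0))) => [|c u v].
  by rewrite !innerDl !innerDr !innerZl !innerZr; ring.
exact: linearP.
Qed.

Lemma separator_convex a b e : is_convex [set q : E | separator a b q <= e].
Proof.
move=> p q t /andP[t0 t1] /= pe qe; rewrite separator_affine.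
have : (1 - t) * separator a b p <= (1 - t) * e by rewrite ler_wpM2l// subr_ge0.
have : t * separator a b q <= t * e by rewrite ler_wpM2l.
by lra.
Qed.

Lemma separator_cvg a b (u : nat -> E) (c : E) : (forall i, u k i @[k --> \oo] --> c i) ->
  separator a b (u k) @[k --> \oo] --> separator a b c.
Proof.
move=> uc; apply: cvg_sumr => i _.
apply: inner_cvg; apply: cvgB => //; try exact: cvg_cst.
  by apply: bounded_op_cvg => //; exact: linearP.
exact: wpart_cvg.
Qed.

Lemma separator_closed gamma a b e : 0 < gamma ->
  form_closed (inner_gamma gamma : E -> E -> R) [set q : E | separator a b q <= e].
Proof.
move=> gamma0 u c ue /(inner_gamma_cvgP gamma0) uc.
have /cvgr_to_le le := separator_cvg (a := a) (b := b) uc; apply: le.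
exact: nearW.
Qed.

Variable T : forall i, H i -> set (H i).

Lemma extended_solutionsP (q : E) :
  extended_solutions T G Gs q <-> forall i, T (G i (q ord0)) (wpart Gs q i).
Proof.
split=> [[Tq Tlast] i|Tq].
  have [->|i0] := eqVneq i ord0; first by rewrite G_last wpart_last.
  by rewrite wpart_other//; exact: Tq.
split=> [i i0|]; first by rewrite -(wpart_other q i0).
by rewrite -wpart_last -[X in T X]G_last.
Qed.

Lemma extended_solution_solution (q : E) :
  extended_solutions T G Gs q -> solution T G Gs (q ord0).
Proof.
move=> /extended_solutionsP Tq; exists (wpart Gs q); split=> //.
exact: wpart_sum.
Qed.

Lemma solution_extended z : solution T G Gs z -> extended_solutions T G Gs !=set0.
Proof.
move=> [u [Tu u0]]; pose q : E := dfwith u ord0 z.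
have q0 : q ord0 = z by exact: dfwithin.
have qi i : i != ord0 -> q i = u i by move=> i0; apply: dfwithout; rewrite eq_sym.
exists q; apply/extended_solutionsP => i; rewrite q0.
have [->|i0] := eqVneq i ord0; last by rewrite wpart_other// qi.
rewrite wpart_last /wlast (eq_bigr (fun i => Gs (u i))) => [|j j0]; last by rewrite qi.
have := u0; rewrite (bigD1 ord0)//= Gs_last => /eqP.
by rewrite addrC addr_eq0 => /eqP ->; rewrite opprK.
Qed.

(** A single inequality on the sum suffices to test membership in every graph.
    For an index whose pair (G_i z, w_i) is in the graph of T_i, that very pair
    is chosen and contributes 0; for the other indices maximality provides a
    pair with a positive contribution.  One index of the second kind would make
    the sum positive. *)
Lemma extended_solutions_separator
    (T_maxmon : forall i, maximal_monotone (@T i)) (q : E) :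
  (forall a b : E, (forall i, T (a i) (b i)) -> separator a b q <= 0) ->
  extended_solutions T G Gs q.
Proof.
move=> sep; apply/extended_solutionsP => j; apply: contrapT => nTj.
have witness i : {ab : H i * H i | T ab.1 ab.2 /\
    let s := '[G i (q ord0) - ab.1, wpart Gs q i - ab.2] in
    s <= 0 /\ (~ T (G i (q ord0)) (wpart Gs q i) -> s < 0)}.
  apply: cid; have [Ti|nTi] := pselect (T (G i (q ord0)) (wpart Gs q i)).
    by exists (G i (q ord0), wpart Gs q i); rewrite /= !subrr linear0l.
  have [a [b [Tab lt0]]] := maximal_monotone_witness (T_maxmon i) nTi.
  by exists (a, b); split=> //; split=> //; exact: ltW.
pose a i := (sval (witness i)).1; pose b i := (sval (witness i)).2.
have Tab i : T (a i) (b i) by exact: (svalP (witness i)).1.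
have term0 i : 0 <= '[G i (q ord0) - a i, b i - wpart Gs q i].
  rewrite -[b i - _]opprB innerNr oppr_ge0.
  exact: (svalP (witness i)).2.1.
have := sep a b Tab; rewrite leNgt => /negP; apply.
rewrite /separator (bigD1 j)//= ltr_pwDl ?sumr_ge0//.
rewrite -[b j - _]opprB innerNr oppr_gt0.
exact: (svalP (witness j)).2.2.
Qed.
End Separators.

(** * The relative-error criterion *)

(** Expanding the square in the criterion leaves
      2 lam (<g - x, y - w> - eps)
        >= (1 - sigma^2) (|g - x|^2 + lam^2 |y - w|^2),
    and after division by 2 lam the coefficients 1/lam and lam are bounded
    below by the minimum of 1/hi and lo. *)
Lemma relative_error_lower_bound (R : realType) (V : hilbertType R) (g x y w : V)
    (lam sigma eps lo hi : R) :
  0 <= sigma < 1 -> 0 < lo -> lo <= lam <= hi ->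
  `|lam *: y + x - (g + lam *: w)| ^+ 2 + 2 * lam * eps
    <= sigma ^+ 2 * (`|g - x| ^+ 2 + `|lam *: (w - y)| ^+ 2) ->
  (1 - sigma ^+ 2) / 2 * Num.min lo hi^-1 * (`|g - x| ^+ 2 + `|y - w| ^+ 2)
    <= '[g - x, y - w] - eps.
Proof.
move=> /andP[s0 s1] lo0 /andP[lolam lamhi].
have lam0 : 0 < lam by exact: lt_le_trans lolam.
have -> : lam *: y + x - (g + lam *: w) = - (g - x) + lam *: (y - w).
  by rewrite (opprD g) opprB scalerBr (addrC (lam *: y)) addrACA.
rewrite (norm_sqrD (- (g - x))) normrN innerNl innerZr !normrZ !exprMn.
rewrite (distrC w y) (gtr0_norm lam0).
set P := `|g - x| ^+ 2; set Q := `|y - w| ^+ 2; set X := '[g - x, y - w].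
have P0 : 0 <= P by exact: sqr_ge0.
have Q0 : 0 <= Q by exact: sqr_ge0.
move: P Q X P0 Q0 => P Q X P0 Q0 crit.
set m := Num.min _ _; have mlo : m <= lo by rewrite ge_min lexx.
have mhi : m <= lam^-1.
  by rewrite ge_min lef_pV2 ?posrE ?lamhi ?orbT// (lt_le_trans lam0).
have s2 : sigma ^+ 2 < 1 by rewrite expr_lt1.
have mP : m * P <= lam^-1 * P by exact: ler_wpM2r.
have mQ : m * Q <= lam * Q by rewrite ler_wpM2r// (le_trans mlo).
rewrite -(ler_pM2l lam0).
have lP : lam * (m * P) <= P.
  by rewrite -ler_pdivlMl.
have lQ : lam * (m * Q) <= lam ^+ 2 * Q by rewrite expr2 -mulrA ler_pM2l.
have : (1 - sigma ^+ 2) * (lam * (m * P) + lam * (m * Q))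
    <= (1 - sigma ^+ 2) * (P + lam ^+ 2 * Q).
  by rewrite ler_wpM2l ?lerD// subr_ge0 ltW.
by lra.
Qed.

(** Passing from a, b to a + g, b + h changes the i-th term by
    <a, h> + <g, b> + <g, h>.  Young's inequality absorbs half of the lower
    bound c (|a|^2 + |b|^2) into the first two products; the rest is quadratic
    in g and h. *)
Lemma residual_bound (R : realType) (I : finType) (V : I -> hilbertType R)
    (a b g h : forall i, V i) (e : I -> R) (c : R) : 0 < c ->
  (forall i, c * (`|a i| ^+ 2 + `|b i| ^+ 2) <= '[a i, b i] - e i) ->
  \sum_i ('[a i + g i, b i + h i] - e i) <= 0 ->
  \sum_i (`|a i| ^+ 2 + `|b i| ^+ 2) <=
    c^-1 * (c^-1 + 1) * \sum_i (`|g i| ^+ 2 + `|h i| ^+ 2).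
Proof.
move=> c0 ab_lower sum_le0.
have term i : `|a i| ^+ 2 + `|b i| ^+ 2 <= 2 * c^-1 * ('[a i + g i, b i + h i] - e i)
    + c^-1 * (c^-1 + 1) * (`|g i| ^+ 2 + `|h i| ^+ 2).
  have lower := ab_lower i.
  have ah := inner_young (a i) (- h i) c0.
  have bg := inner_young (b i) (- g i) c0.
  have gh := inner_young (g i) (- h i) (@ltr01 R).
  rewrite !innerNr !normrN in ah bg gh.
  rewrite innerDl !innerDr (inner_sym (g i) (b i)).
  rewrite -(ler_pM2l c0).
  have -> : c * (2 * c^-1 *
        ('[a i, b i] + '[a i, h i] + ('[b i, g i] + '[g i, h i]) - e i) +
      c^-1 * (c^-1 + 1) * (`|g i| ^+ 2 + `|h i| ^+ 2)) =
    2 * ('[a i, b i] + '[a i, h i] + ('[b i, g i] + '[g i, h i]) - e i) +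
      (c^-1 + 1) * (`|g i| ^+ 2 + `|h i| ^+ 2) by field; rewrite gt_eqF.
  by rewrite invr1 in gh; lra.
apply: le_trans (ler_sum _ (fun i _ => term i)) _.
rewrite big_split /= -!mulr_sumr gerDr mulr_ge0_le0// mulr_ge0// invr_ge0 ltW//.
Qed.

(** * Analysis of a run *)

Section Run.
Variables (R : realType) (n : nat) (H : 'I_n.+2 -> hilbertType R).
Variables (T : forall i, H i -> set (H i)).
Variables (G : forall i, {linear H ord0 -> H i}) (Gs : forall i, H i -> H ord0).
Hypothesis T_maxmon : forall i, maximal_monotone (@T i).
Hypothesis G_bounded : forall i, bounded_op (G i).
Hypothesis G_adjoint : forall i, is_adjoint (G i) (@Gs i).
Hypothesis G_last : forall z, G ord0 z = z.
Hypothesis solvable : exists z, solution T G Gs z.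
Variables (sigma gamma : R) (alpha beta : nat -> R).
Variables (lambda eps : nat -> 'I_n.+2 -> R) (p x y : nat -> forall i, H i).
Hypothesis run : algorithm1 T G Gs sigma gamma alpha beta lambda eps p x y.
Variables (lambda_inf lambda_sup : R).
Hypothesis lambda_inf_gt0 : 0 < lambda_inf.
Hypothesis lambda_bounds : forall k i, lambda_inf <= lambda k i <= lambda_sup.
Hypothesis alpha_bounded : has_ubound (range alpha).
Hypothesis beta_summable : (\sum_(0 <= k <oo) (beta k ^+ 2)%:E < +oo)%E.

Local Notation E := (prod_space H).
Local Notation B := (inner_gamma gamma : E -> E -> R).
Local Notation S := (extended_solutions T G Gs : set E).
Local Notation pt := (ptilde alpha beta p).
Let gamma0 : 0 < gamma := gamma_gt0 run.
Let S_neq0 : S !=set0.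
Proof. by have [z /(solution_extended G_adjoint G_last)] := solvable. Qed.

Lemma phi_separator k (q : E) :
  phi G Gs eps x y k q = separator G Gs (x k) (y k) q - \sum_i eps k i.
Proof. by rewrite /phi sumrB. Qed.

Lemma Hset_convex k : is_convex (Hset G Gs eps x y k : set E).
Proof.
have -> : (Hset G Gs eps x y k : set E) =
    [set q | separator G Gs (x k) (y k) q <= \sum_i eps k i].
  by apply/seteqP; split=> q /=; rewrite /Hset /= phi_separator subr_le0.
exact: separator_convex.
Qed.

(** Each term of phi is nonpositive on S by the definition of the enlargement. *)
Lemma extended_solutions_sub_Hset k : S `<=` Hset G Gs eps x y k.
Proof.
move=> q /(extended_solutionsP Gs G_last) Tq; apply: sumr_le0 => i _.
rewrite subr_le0 -(opprB (x k i)) innerNl lerNl.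
exact: y_enlargement run k i _ _ (Tq i).
Qed.

Lemma iterate_projection k : form_projection B
  (Hset G Gs eps x y k `&`
    [set q : E | B ((p 0%N : E) - (p k : E)) (q - (p k : E)) <= 0])
  (p 0%N) (p k.+1).
Proof. by apply/(is_projectionP gamma0); exact: next_iterate run k. Qed.

Lemma iterate_bounded i : bounded_seq (fun k => p k i).
Proof.
have [q Sq] := S_neq0.
apply: (inner_gamma_bounded gamma0 (u := p : nat -> E) (c := p 0%N)
  (D := B ((p 0%N : E) - q) ((p 0%N : E) - q))).
move=> k; exact: (haugazeau_dist (inner_gamma_form H gamma0) Hset_convex
  extended_solutions_sub_Hset iterate_projection k Sq).
Qed.

Lemma iterate_step i : p k.+1 i - p k i @[k --> \oo] --> (0 : H i).
Proof.
have := haugazeau_step (inner_gamma_form H gamma0) Hset_convex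
  extended_solutions_sub_Hset S_neq0 iterate_projection.
by move=> /(inner_gamma_nullP gamma0 (fun k => (p k.+1 : E) - (p k : E))); apply.
Qed.

(** The inertial term is a bounded factor times a vanishing step, the second
    extrapolation is a vanishing factor times a bounded vector. *)
Lemma extrapolation_null i : pt k i - p k i @[k --> \oo] --> (0 : H i).
Proof.
(* At k = 0 the difference p 0 - p 0.-1 is 0; shifting by one drops it. *)
have back : p k i - p k.-1 i @[k --> \oo] --> (0 : H i).
  by rewrite -cvg_shiftS; exact: iterate_step.
have alpha_seq : bounded_seq alpha.
  have [M aM] := alpha_bounded; exists M => k.
  by rewrite ger0_norm ?(alpha_ge0 run)//; apply: aM; exists k.
have inertia : alpha k *: (p k i - p k.-1 i) @[k --> \oo] --> (0 : H i).
  exact: bounded_scale_null.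
have [M inertiaM] : bounded_seq (fun k => alpha k *: (p k i - p k.-1 i)).
  have [Ma aM] := alpha_seq; have [Mp pM] := iterate_bounded i.
  exists (Ma * (Mp + Mp)) => k; rewrite normrZ ler_pM//.
  by rewrite (le_trans (ler_normB _ _))// lerD.
have hat : bounded_seq (fun k => phat alpha p k i - p 0%N i).
  apply: bounded_seqD; last exact: bounded_seq_cst.
  by apply: bounded_seqD; [exact: iterate_bounded|exists M].
have split k : pt k i - p k i =
    alpha k *: (p k i - p k.-1 i) + beta k *: (phat alpha p k i - p 0%N i).
  by rewrite /ptilde {1}/phat addrAC [X in X + _]addrAC subrr add0r.
under eq_fun do rewrite split.
rewrite -(addr0 (0 : H i)); apply: cvgD inertia _.
exact: null_scale_bounded (square_summable_null beta_summable) hat.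
Qed.

Lemma lookahead_null i : p k.+1 i - pt k i @[k --> \oo] --> (0 : H i).
Proof.
have split k : p k.+1 i - pt k i = (p k.+1 i - p k i) - (pt k i - p k i).
  by rewrite opprB addrA subrK.
under eq_fun do rewrite split.
rewrite -(subr0 (0 : H i)); apply: cvgB; [exact: iterate_step|exact: extrapolation_null].
Qed.

Local Notation wp q := (wpart Gs q).

Lemma wpart_lookahead_null i : wp (p k.+1) i - wp (pt k) i @[k --> \oo] --> (0 : H i).
Proof.
by apply: (wpart_sub_null G_adjoint G_bounded) => j; exact: lookahead_null.
Qed.

Let c := (1 - sigma ^+ 2) / 2 * Num.min lambda_inf lambda_sup^-1.

Let c_gt0 : 0 < c.
Proof.
have /andP[s0 s1] := sigma_range run.
have sup0 : 0 < lambda_sup.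
  have /andP[inf_le le_sup] := lambda_bounds 0%N ord0.
  exact: lt_le_trans lambda_inf_gt0 (le_trans inf_le le_sup).
by rewrite mulr_gt0 ?divr_gt0 ?subr_gt0 ?expr_lt1// lt_min lambda_inf_gt0 invr_gt0.
Qed.

Lemma separation_lower_bound k i :
  c * (`|G i (ztilde alpha beta p k) - x k i| ^+ 2 + `|y k i - wp (pt k) i| ^+ 2)
  <= '[G i (ztilde alpha beta p k) - x k i, y k i - wp (pt k) i] - eps k i.
Proof.
exact: relative_error_lower_bound (sigma_range run) lambda_inf_gt0
  (lambda_bounds k i) (error_criterion run k i).
Qed.

(** Compares phi_k at ptilde^k, where it dominates the residuals, with phi_k at
    p^(k+1), where it is nonpositive because p^(k+1) lies in H_k. *)
Lemma residual_null : \sum_i (`|G i (ztilde alpha beta p k) - x k i| ^+ 2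
    + `|y k i - wp (pt k) i| ^+ 2) @[k --> \oo] --> (0 : R).
Proof.
pose g k i := G i (p k.+1 ord0 - pt k ord0).
pose h k i := wp (pt k) i - wp (p k.+1) i.
apply: (@null_le _ _ (fun k =>
  c^-1 * (c^-1 + 1) * \sum_i (`|g k i| ^+ 2 + `|h k i| ^+ 2))).
  move=> k; apply/andP; split.
    by apply: sumr_ge0 => i _; rewrite addr_ge0// sqr_ge0.
  apply: (residual_bound c_gt0 (separation_lower_bound k)).
  have [[phi_le0 _] _] := next_iterate run k.
  rewrite (eq_bigr (fun i =>
    '[G i (p k.+1 ord0) - x k i, y k i - wp (p k.+1) i] - eps k i))//.
  move=> i _; rewrite /g /h /ztilde linearB; congr ('[_, _] - _).
    by rewrite [LHS]addrC addrA subrK.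
  by rewrite addrA subrK.
suff sum0 : \sum_i (`|g k i| ^+ 2 + `|h k i| ^+ 2) @[k --> \oo] --> (0 : R).
  by have := cvgMl_tmp (a := c^-1 * (c^-1 + 1)) sum0; rewrite mulr0; apply.
apply: null_sum => i _.
rewrite -(addr0 (0 : R)); apply: cvgD; apply/norm_sqr_null.
  by apply: bounded_op_null => //; exact: lookahead_null.
have hN k : h k i = - (wp (p k.+1) i - wp (pt k) i) by rewrite opprB.
under eq_fun do rewrite hN.
by rewrite -(oppr0 (H i)); apply: cvgN; exact: wpart_lookahead_null.
Qed.

Lemma residual_sqr_null i :
  `|G i (ztilde alpha beta p k) - x k i| ^+ 2 + `|y k i - wp (pt k) i| ^+ 2
    @[k --> \oo] --> (0 : R).
Proof.
apply: null_le residual_null => k; rewrite addr_ge0 ?sqr_ge0//= (bigD1 i)//= lerDl.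
by apply: sumr_ge0 => j _; rewrite addr_ge0// sqr_ge0.
Qed.

Lemma x_residual_null i : x k i - G i (ztilde alpha beta p k) @[k --> \oo] --> (0 : H i).
Proof.
apply/norm_sqr_null; apply: null_le (residual_sqr_null i) => k.
by rewrite sqr_ge0 distrC lerDl sqr_ge0.
Qed.

Lemma y_residual_null i : y k i - wp (pt k) i @[k --> \oo] --> (0 : H i).
Proof.
apply/norm_sqr_null; apply: null_le (residual_sqr_null i) => k.
by rewrite sqr_ge0 lerDr sqr_ge0.
Qed.

(** The lower bound is nonnegative, so eps is at most the inner product of the
    residuals. *)
Lemma eps_null i : eps k i @[k --> \oo] --> (0 : R).
Proof.
apply: null_le (residual_sqr_null i) => k; rewrite (eps_ge0 run)/=.
have := separation_lower_bound k i; set u := _ - x k i; set v := y k i - _.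
have := inner_young u v (@ltr01 R); rewrite invr1 => young.
have uv0 : 0 <= `|u| ^+ 2 + `|v| ^+ 2 by rewrite addr_ge0// sqr_ge0.
have : 0 <= c * (`|u| ^+ 2 + `|v| ^+ 2) by rewrite mulr_ge0 ?(ltW c_gt0).
by lra.
Qed.

Lemma x_iterate_null i : x k i - G i (p k ord0) @[k --> \oo] --> (0 : H i).
Proof.
have split k : x k i - G i (p k ord0) =
    (x k i - G i (ztilde alpha beta p k)) + G i (pt k ord0 - p k ord0).
  by rewrite linearB addrA subrK.
under eq_fun do rewrite split.
rewrite -(addr0 (0 : H i)); apply: cvgD; first exact: x_residual_null.
by apply: bounded_op_null => //; exact: extrapolation_null.
Qed.

Lemma y_iterate_null i : y k i - wp (p k) i @[k --> \oo] --> (0 : H i).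
Proof.
have split k : y k i - wp (p k) i = (y k i - wp (pt k) i) + (wp (pt k) i - wp (p k) i).
  by rewrite addrA subrK.
under eq_fun do rewrite split.
rewrite -(addr0 (0 : H i)); apply: cvgD; first exact: y_residual_null.
by apply: (wpart_sub_null G_adjoint G_bounded) => j; exact: extrapolation_null.
Qed.

Lemma wpart_iterate_bounded i : bounded_seq (fun k => wp (p k) i).
Proof.
exact: (wpart_bounded G_adjoint G_bounded iterate_bounded).
Qed.

(** The enlargement inequality for (x_i^k, y_i^k) against (a_i, b_i) is the
    desired inequality at p^k, up to eps_i^k and to inner products in which one
    factor vanishes and the other stays bounded. *)
Lemma separator_iterate_le (a b : E) (e : R) : (forall i, T (a i) (b i)) -> 0 < e ->
  \forall k \near \oo, separator G Gs a b (p k) <= e.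
Proof.
move=> Tab e0.
pose xi k i := x k i - G i (p k ord0); pose eta k i := y k i - wp (p k) i.
pose r k i := eps k i + '[wp (p k) i - b i, xi k i] + '[G i (p k ord0) - a i, eta k i]
  + '[xi k i, eta k i].
have sep_le k : separator G Gs a b (p k) <= \sum_i r k i.
  apply: ler_sum => i _.
  have /(_ _ _ (Tab i)) : enlargement (@T i) (eps k i) (x k i) (y k i).
    exact: y_enlargement run _ _.
  have -> : x k i - a i = (G i (p k ord0) - a i) + xi k i.
    by rewrite /xi [RHS]addrC addrA subrK.
  have -> : y k i - b i = (wp (p k) i - b i) + eta k i.
    by rewrite /eta [RHS]addrC addrA subrK.
  rewrite /r -(opprB (wp (p k) i)) innerNr.
  move: (G i (p k ord0) - a i) (wp (p k) i - b i) (xi k i) (eta k i) => A W X Y.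
  rewrite innerDl !innerDr.
  by rewrite (inner_sym X W); lra.
have r0 : \sum_i r k i @[k --> \oo] --> (0 : R).
  apply: null_sum => i _; rewrite -(addr0 (0 : R)); apply: cvgD.
    rewrite -(addr0 (0 : R)); apply: cvgD.
      rewrite -(addr0 (0 : R)); apply: cvgD; first exact: eps_null.
      apply: inner_null; last exact: x_iterate_null.
      apply: bounded_seqD; last exact: bounded_seq_cst.
      exact: wpart_iterate_bounded.
    apply: inner_null; last exact: y_iterate_null.
    apply: bounded_seqD; last exact: bounded_seq_cst.
    by apply: bounded_op_seq => //; exact: iterate_bounded.
  rewrite -(linear0l (@inner R (H i)) 0).
  by apply: inner_cvg; [exact: x_iterate_null|exact: y_iterate_null].
move/cvgr0Pnorm_le: r0 => /(_ _ e0); apply: filterS => k rk.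
by apply: le_trans (sep_le k) _; exact: le_trans (ler_norm _) rk.
Qed.

Lemma cluster_extended_solution (q : E) :
  (forall A : set E, form_closed B A -> is_convex A ->
    (\forall k \near \oo, A (p k)) -> A q) -> S q.
Proof.
move=> cluster; apply: (extended_solutions_separator G_last T_maxmon) => a b Tab.
apply/ler_addgt0Pr => e e0; rewrite add0r.
apply: (cluster [set q | separator G Gs a b q <= e]).
- exact: separator_closed.
- exact: separator_convex.
- exact: separator_iterate_le.
Qed.

Lemma iterate_converges : exists q : E,
  form_projection B S (p 0%N) q /\ form_cvg B (p : nat -> E) q.
Proof.
have [q] := haugazeau_cvg (inner_gamma_form H gamma0) Hset_convex
  extended_solutions_sub_Hset S_neq0 iterate_projection
  (inner_gamma_complete (H := H) gamma0) cluster_extended_solution.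
by exists q.
Qed.
End Run.

Unset Implicit Arguments.
Set Strict Implicit.
Set Printing Implicit Defensive.

Theorem theorem3p13 (R : realType) (n : nat) (H : 'I_n.+2 -> hilbertType R)
  (T : forall i, H i -> set (H i))
  (G : forall i, {linear H ord0 -> H i}) (Gs : forall i, H i -> H ord0)
  (T_maxmon : forall i, maximal_monotone (T i))
  (G_bounded : forall i, bounded_op (G i))
  (G_adjoint : forall i, is_adjoint (G i) (Gs i))
  (G_last : forall z, G ord0 z = z)
  (solvable : exists z, solution T G Gs z)
  (sigma gamma : R) (alpha beta : nat -> R)
  (lambda eps : nat -> 'I_n.+2 -> R) (p x y : nat -> forall i, H i)
  (run : algorithm1 T G Gs sigma gamma alpha beta lambda eps p x y)
  (lambda_inf lambda_sup : R)
  (lambda_inf_gt0 : 0 < lambda_inf) (lambda_inf_sup : lambda_inf <= lambda_sup)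
  (lambda_bounds : forall k i, lambda_inf <= lambda k i <= lambda_sup)
  (alpha_bounded : has_ubound (range alpha))
  (beta_summable : (\sum_(0 <= k <oo) (beta k ^+ 2)%:E < +oo)%E) :
  exists pstar : forall i, H i,
    let zstar := pstar ord0 in
    let wstar := wpart Gs pstar in
    is_projection gamma (extended_solutions T G Gs) (p 0%N) pstar /\
    norm_gamma gamma (sub_point (p k) pstar) @[k --> \oo] --> 0 /\
    p k ord0 @[k --> \oo] --> zstar /\
    solution T G Gs zstar /\
    (forall i, wpart Gs (p k) i @[k --> \oo] --> wstar i) /\
    (forall i, x k i @[k --> \oo] --> G i zstar) /\
    (forall i, y k i @[k --> \oo] --> wstar i).
Proof.
have gamma0 := gamma_gt0 run.
have [q [q_proj /(inner_gamma_cvgP gamma0) pq]] :=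
  iterate_converges T_maxmon G_bounded G_adjoint G_last solvable run
    lambda_inf_gt0 lambda_bounds alpha_bounded beta_summable.
have wq i : wpart Gs (p k) i @[k --> \oo] --> wpart Gs q i.
  exact: (wpart_cvg G_adjoint G_bounded).
exists q; split; first exact/(is_projectionP gamma0).
split.
  rewrite -(sqrtr0 R); apply: continuous_cvg; first exact: sqrt_continuous.
  exact/(inner_gamma_cvgP gamma0 p q).
split; first exact: pq.
split; first by apply: (extended_solution_solution G_adjoint G_last); have [] := q_proj.
split; first exact: wq.
split=> i.
  apply: (@cvg_of_sub_null _ _ _ (fun k => G i (p k ord0))).
    apply: (x_iterate_null G_bounded G_adjoint G_last solvable run
      lambda_inf_gt0 lambda_bounds) => //.
  by apply: bounded_op_cvg => //; exact: linearP.
apply: cvg_of_sub_null (wq i).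
apply: (y_iterate_null G_bounded G_adjoint G_last solvable run
  lambda_inf_gt0 lambda_bounds) => //.
Qed.
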